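(* Let $\varphi:\mathbb{Z}^m\times\mathbb{Z}^m\to\mathbb{Z}$ be a full, alternating, bilinear map. Then $\varphi$ is given by $\varphi(w,w')=w^TAw'$ for some skew-symmetric matrix $A\in\mathbb{Z}^{m\times m}$, and $\mathrm{RF}_{G_\varphi}\approx\log^{(\operatorname{rank}A)+1}$.
   Context: Residual finiteness growth: let $G$ be a finitely generated residually finite group with finite generating set $S$, neutral element $e$, and word norm $\|\cdot\|_S$; put $B_S(r)=\{g\in G\mid \|g\|_S\le r\}$. Let $D_G(g)=\min\{[G:N]\mid g\notin N, N\lhd G\}$ for $g\ne e$, and $\mathrm{RF}_{G,S}(r)=\max\{D_G(g)\mid e\neq g\in B_S(r)\}$ for real $r\geq 1$. For non-decreasing functions on $\mathbb{R}_{\ge1}$, $f\preceq g$ means there is $C>0$ with $f(r)\le C g(Cr)$ for all $r\ge\max\{1,1/C\}$, and $f\approx g$ means $f\preceq g$ and $g\preceq f$. $\mathrm{RF}_G$ is the $\approx$-class of $\mathrm{RF}_{G,S}$ (independent of $S$); $\log^k$ is $r\mapsto(\log r)^k$. A bilinear map $\varphi:\mathbb{Z}^m\times\mathbb{Z}^m\to\mathbb{Z}$ is alternating if $\varphi(w,w')=-\varphi(w',w)$ for all $w,w'$, and full if its values generate a finite index subgroup of $\mathbb{Z}$ (i.e. $\varphi\neq0$). Let $A^L$ be $A$ with its upper triangular part set to zero and $\varphi^L(w,w')=w^TA^Lw'$. $G_\varphi$ is the set $\mathbb{Z}^m\times\mathbb{Z}$ with product $(w_1,v_1)(w_2,v_2)=(w_1+w_2,v_1+v_2+\varphi^L(w_1,w_2))$;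 it is a torsion-free, finitely generated, two-step nilpotent group. *)

(* Defs.v *)
From HB Require Import structures.
From mathcomp Require Import all_boot all_order all_algebra.
From mathcomp Require Import all_classical all_reals all_analysis.
From mathcomp Require Import ring.

Set Implicit Arguments.
Unset Strict Implicit.
Unset Printing Implicit Defensive.

Import Order.TTheory GRing.Theory Num.Theory.
Local Open Scope classical_set_scope.
Local Open Scope ring_scope.

(* The minimum of P; the junk value 0 is only taken when P is empty. *)
Definition min_nat (P : set nat) : nat :=
  if pselect (exists n, `[< P n >]) is left exP then ex_minn exP else 0%N.

Section ResidualFiniteness.
Local Open Scope group_scope.
Variable G : groupType.
Implicit Types (S H N : set G) (g : G).

Definition is_subgroup H : Prop :=
  H 1 /\ (forall x y, H x -> H y -> H (x / y)).

Definition is_normal_subgroup N : Prop :=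
  is_subgroup N /\ (forall x g, N x -> N (x ^ g)).

Definition left_cosets N : set (set G) :=
  [set [set g * x | x in N] | g in [set: G]].

Definition has_index N (n : nat) : Prop := (left_cosets N #= `I_n)%card.

Definition generates S : Prop := smallest is_subgroup S = [set: G].

Definition finite_generating S : Prop := finite_set S /\ generates S.

Definition finitely_generated : Prop := exists S, finite_generating S.

Definition residually_finite : Prop := forall g, g != 1 ->
  exists N, [/\ is_normal_subgroup N, (exists n, has_index N n) & ~ N g].

(* Words are sequences of letters in the union of S and its inverses. *)
Definition word_norm S g : nat :=
  min_nat [set n | exists w : seq G,
    [/\ size w = n, (forall x, x \in w -> S x \/ S x^-1)
      & \prod_(x <- w) x = g]].

Definition divisibility g : nat :=
  min_nat [set n | exists N, [/\ is_normal_subgroup N, ~ N g & has_index N n]].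

Definition word_ball (R : realType) S (r : R) : set G :=
  [set g | ((word_norm S g)%:R <= r)%R].

(* When S is finite and generates G, the ball is finite and this is a maximum
   over finitely many elements. *)
Definition RF (R : realType) S (r : R) : R :=
  (\big[maxn/0%N]_(g \in [set g | word_ball S r g /\ g != 1]) divisibility g)%:R.

End ResidualFiniteness.

Section Growth.
Variable R : realType.
Implicit Types f g h : R -> R.

Definition growth_le f g : Prop := exists2 C : R, 0 < C &
  forall r, Num.max 1 C^-1 <= r -> f r <= C * g (C * r).

Definition growth_eq f g : Prop := growth_le f g /\ growth_le g f.

(* RF_G, as a growth class, is that of h.  The class only makes sense for
   finitely generated residually finite groups, and does not depend on the
   finite generating set. *)
Definition RF_growth (G : groupType) h : Prop :=
  [/\ finitely_generated G, residually_finite G &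
    forall S : set G, finite_generating S -> growth_eq (RF S) h].

Definition log_pow (k : nat) : R -> R := fun r => ln r ^+ k.

End Growth.

Definition is_zsubgroup (H : set int) : Prop :=
  H 0 /\ (forall x y, H x -> H y -> H (x - y)).

Definition finite_index_int (H : set int) : Prop :=
  finite_set [set [set a + x | x in H] | a in [set: int]].

Section Forms.
Variable m : nat.
Implicit Type phi : 'cV[int]_m -> 'cV[int]_m -> int.

Definition alternating_form phi : Prop := forall w w', phi w w' = - phi w' w.

Definition full_form phi : Prop := finite_index_int
  (smallest is_zsubgroup [set phi p.1 p.2 | p in [set: 'cV[int]_m * 'cV[int]_m]]).

Definition matrix_form (A : 'M[int]_m) (w w' : 'cV[int]_m) : int :=
  (w^T *m A *m w') 0 0.

(* Strictly lower triangular part; for skew-symmetric A the diagonal is 0. *)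
Definition lower_part (A : 'M[int]_m) : 'M[int]_m :=
  \matrix_(i, j) (if (j < i)%N then A i j else 0).

Definition int_rank (A : 'M[int]_m) : nat :=
  \rank (map_mx (intr : int -> rat) A).

(* The group G_phi, for phi the form of A.  A one-field record rather than a
   product, so as not to inherit the componentwise structures of products. *)
Record Gphi (A : 'M[int]_m) := MkGphi { gpair : 'cV[int]_m * int }.

End Forms.

Section GphiGroup.
Variables (m : nat) (A : 'M[int]_m).
Local Notation phiL := (matrix_form (lower_part A)).

HB.instance Definition _ := [isNew for @gpair m A].
HB.instance Definition _ := [Choice of Gphi A by <:].

Definition Gphi_one : Gphi A := MkGphi A (0, 0).

Definition Gphi_mul (x y : Gphi A) : Gphi A :=
  let: (w1, v1) := gpair x in let: (w2, v2) := gpair y in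
  MkGphi A (w1 + w2, v1 + v2 + phiL w1 w2).

Definition Gphi_inv (x : Gphi A) : Gphi A :=
  let: (w, v) := gpair x in MkGphi A (- w, - v + phiL w w).

Lemma matrix_formDl (B : 'M[int]_m) u v w :
  matrix_form B (u + v) w = matrix_form B u w + matrix_form B v w.
Proof. by rewrite /matrix_form linearD /= !mulmxDl mxE. Qed.

Lemma matrix_formDr (B : 'M[int]_m) u v w :
  matrix_form B u (v + w) = matrix_form B u v + matrix_form B u w.
Proof. by rewrite /matrix_form mulmxDr mxE. Qed.

Lemma matrix_formNl (B : 'M[int]_m) u v :
  matrix_form B (- u) v = - matrix_form B u v.
Proof. by rewrite /matrix_form linearN /= !mulNmx mxE. Qed.

Lemma matrix_formNr (B : 'M[int]_m) u v :
  matrix_form B u (- v) = - matrix_form B u v.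
Proof. by rewrite /matrix_form mulmxN mxE. Qed.

Lemma matrix_form0l (B : 'M[int]_m) u : matrix_form B 0 u = 0.
Proof. by rewrite /matrix_form linear0 !mul0mx mxE. Qed.

Lemma matrix_form0r (B : 'M[int]_m) u : matrix_form B u 0 = 0.
Proof. by rewrite /matrix_form mulmx0 mxE. Qed.

Lemma Gphi_mulA : associative Gphi_mul.
Proof.
move=> [[w1 v1]] [[w2 v2]] [[w3 v3]]; rewrite /Gphi_mul /=.
congr (MkGphi A (_, _)); first by rewrite addrA.
rewrite matrix_formDl matrix_formDr; ring.
Qed.

Lemma Gphi_mul1 : left_id Gphi_one Gphi_mul.
Proof. by move=> [[w v]]; rewrite /Gphi_mul /= !add0r matrix_form0l addr0. Qed.

Lemma Gphi_mul1r : right_id Gphi_one Gphi_mul.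
Proof. by move=> [[w v]]; rewrite /Gphi_mul /= matrix_form0r !addr0. Qed.

Lemma Gphi_mulV : left_inverse Gphi_one Gphi_inv Gphi_mul.
Proof.
move=> [[w v]]; rewrite /Gphi_mul /Gphi_one /=; congr (MkGphi A (_, _)).
  by rewrite addNr.
by rewrite matrix_formNl; ring.
Qed.

Lemma Gphi_mulrV : right_inverse Gphi_one Gphi_inv Gphi_mul.
Proof.
move=> [[w v]]; rewrite /Gphi_mul /Gphi_one /=; congr (MkGphi A (_, _)).
  by rewrite subrr.
by rewrite matrix_formNr; ring.
Qed.

HB.instance Definition _ := isGroup.Build (Gphi A)
  Gphi_mulA Gphi_mul1 Gphi_mul1r Gphi_mulV Gphi_mulrV.

End GphiGroup.

(* Main.v *)
(** Write [x = (w, v)] and [k = rank A].  If [U] consists of [k] independent rows of [A], then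
    [e A] is a left multiple of [U] for some [e > 0], and [2 v - phiL(w, w)] is additive modulo [l]
    on every subgroup where [phi] vanishes modulo [l].

    Upper bound: let [x <> 1] have norm at most [r].  Some nonzero integer [a], namely a coordinate
    of [w] or [2 v], is [O(r^2)], and the least [l] not dividing [a] is [O(log a)], since the
    binomial coefficient [C(2n, n) >= 2^n] divides every common multiple of [1, ..., 2n].  Then [x]
    lies outside [{l | w_i}] or outside [{U w = 0 mod l e, l | 2 v - phiL(w, w)}], normal subgroups
    of index at most [l] and [(l e)^k l].

    Lower bound: the product of [C(2^(i+1), 2^i)] over [i < j] is a multiple [v] of every integer up
    to [Q = 2^j] and is at most [4^Q].  A normal subgroup avoiding the central element [(0, v)]
    avoids [(0, s)] for [0 < s <= Q], hence also all elements with a nontrivial commutator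
    [(0, phi(w, w'))] with [|phi(w, w')| <= Q].  So a box of [k] coordinates of size about [Q],
    times [0 <= s <= Q] in the center, embeds into the quotient, whose order is therefore at
    least a constant times [Q^(k+1)]. *)
Require Import Defs.
From HB Require Import structures.
From mathcomp Require Import all_boot all_order all_algebra.
From mathcomp Require Import all_classical all_reals all_analysis.
From mathcomp Require Import zify ring lra.

Set Implicit Arguments.
Unset Strict Implicit.
Unset Printing Implicit Defensive.

Import Order.TTheory GRing.Theory Num.Theory.
Local Open Scope ring_scope.

(** * Common multiples of initial intervals *)

Section CommonMultiples.
Local Open Scope nat_scope.

Lemma double_divn_le n d : 0 < d -> (n %/ d).*2 <= n.*2 %/ d.
Proof.
by move=> d0; rewrite leq_divRL // -muln2 mulnAC -muln2 leq_mul2r leq_divM orbT.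
Qed.

(** Legendre's formula for the factorials in [bin_fact]; the sum for [n!] is extended by zero terms
    to the range of the sum for [(2n)!], so that they subtract term by term. *)
Lemma logn_central_bin p n : prime p ->
  logn p 'C(n.*2, n) =
  \sum_(1 <= k < n.*2.+1) (n.*2 %/ p ^ k - (n %/ p ^ k).*2).
Proof.
move=> pp.
have le_n2n : n <= n.*2 by rewrite -addnn leq_addl.
have widen : logn p n`! = \sum_(1 <= k < n.*2.+1) n %/ p ^ k.
  rewrite logn_fact // [RHS](@big_cat_nat _ _ _ n.+1) //=.
  rewrite [X in _ = (_ + X)%N]big1_seq ?addn0 //.
  move=> k /andP[_]; rewrite mem_index_iota => /andP[nk _].
  by rewrite divn_small // (leq_trans nk) // ltnW // ltn_expl // prime_gt1.
have := congr1 (logn p) (bin_fact le_n2n).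
rewrite -{2}addnn addnK lognM ?lognM ?bin_gt0 ?muln_gt0 ?fact_gt0 //.
rewrite widen logn_fact // addnn -[(\sum_(_ <= _ < _) _).*2]muln2 big_distrl /= => eq2n.
rewrite -[LHS](addnK (\sum_(1 <= k < n.*2.+1) (n %/ p ^ k) * 2)) eq2n.
rewrite sumnB => [|k _]; first by congr (_ - _); apply: eq_bigr => k _; rewrite muln2.
by rewrite double_divn_le // expn_gt0 prime_gt0.
Qed.

Lemma dvdn_logn d m : 0 < d ->
  (forall p, prime p -> p ^ logn p d %| m) -> d %| m.
Proof.
move=> d0 pd; apply/dvdn_partP => // p.
rewrite mem_primes => /andP[pp _]; rewrite p_part; exact: pd.
Qed.

(** Every prime power dividing the binomial coefficient is at most [2n], hence is itself one of the
    [d]. *)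
Lemma central_bin_dvdn n x :
  (forall d, 0 < d <= n.*2 -> d %| x) -> 'C(n.*2, n) %| x.
Proof.
move=> dx; apply: dvdn_logn; first by rewrite bin_gt0 -addnn leq_addl.
move=> p pp; have p1 := prime_gt1 pp; have p0 := prime_gt0 pp.
rewrite logn_central_bin //.
case: (posnP n) => [->|n0]; first by rewrite big_geq // dvd1n.
apply: dvdn_trans (_ : p ^ trunc_log p n.*2 %| x); last first.
  by apply: dx; rewrite expn_gt0 p0 trunc_logP // double_gt0.
(* The terms of the valuation are at most 1, and vanish once [p ^ k > 2 n]. *)
apply: dvdn_exp2l.
have nt : trunc_log p n.*2 <= n.*2.
  rewrite -ltnS -(ltn_exp2l _ _ p1) (leq_ltn_trans (trunc_logP p1 _)) ?double_gt0 //.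
  by rewrite (ltn_trans (ltnSn _)) // ltn_expl.
rewrite (@big_cat_nat _ _ _ (trunc_log p n.*2).+1) //=.
rewrite [X in (_ + X)%N]big1_seq ?addn0.
  apply: leq_trans (_ : \sum_(1 <= k < (trunc_log p n.*2).+1) 1 <= _).
    apply: leq_sum => k _.
    have pk : 0 < p ^ k by rewrite expn_gt0 p0.
    have := double_divn_le n pk; have := ltn_pmod n pk.
    have := divn_eq n (p ^ k); have := divn_eq n.*2 (p ^ k).
    have := ltn_pmod n.*2 pk; nia.
  by rewrite sum_nat_const_nat muln1 subn1.
move=> k /andP[_]; rewrite mem_index_iota => /andP[tk _].
by rewrite divn_small // (leq_trans (trunc_log_ltn n.*2 p1)) // leq_exp2l.
Qed.

Lemma central_bin_ge n : 2 ^ n <= 'C(n.*2, n).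
Proof.
elim: n => // n IH.
have sym : 'C(n.*2.+1, n) = 'C(n.*2.+1, n.+1).
  have lt1 : n.+1 <= n.*2.+1 by lia.
  by rewrite -(bin_sub lt1); congr (binomial _ _); lia.
rewrite doubleS binS -sym sym binS expnS; lia.
Qed.

Lemma central_bin_le n : 'C(n.*2, n) <= 4 ^ n.
Proof.
have -> : 4 ^ n = \sum_(i < n.*2.+1) 'C(n.*2, i).
  rewrite (_ : 4 = (1 + 1) ^ 2) // -expnM mul2n expnDn.
  by apply: eq_bigr => i _; rewrite !exp1n !muln1.
have lt : n < n.*2.+1 by lia.
by rewrite (bigD1 (Ordinal lt)) //= leq_addr.
Qed.

(** Stands in for the least common multiple of 1, ..., [2 ^ j]: the factors are at most [4 ^ 2 ^ i],
    and the exponents [2 ^ i] add up to less than [2 ^ j]. *)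
Definition common_multiple j := \prod_(i < j) 'C((2 ^ i).*2, 2 ^ i).

Lemma common_multiple_gt0 j : 0 < common_multiple j.
Proof. by apply: prodn_gt0 => i; rewrite bin_gt0 -addnn leq_addl. Qed.

Lemma common_multiple_le j : common_multiple j <= 4 ^ 2 ^ j.
Proof.
elim: j => [|j IH]; first by rewrite /common_multiple big_ord0.
rewrite /common_multiple big_ord_recr /=.
have -> : 2 ^ j.+1 = 2 ^ j + 2 ^ j by rewrite expnS mul2n addnn.
by rewrite expnD; apply: leq_mul => //; apply: central_bin_le.
Qed.

Lemma dvdn_common_multiple j d : 0 < d <= 2 ^ j -> d %| common_multiple j.
Proof.
elim: j d => [|j IH] d; first by case: d => [|[|]].
move=> /andP[d0 dj]; apply: dvdn_logn => // p pp.
have p1 := prime_gt1 pp; have p0 := prime_gt0 pp.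
have pj : p ^ logn p d <= (2 ^ j).*2.
  by rewrite -mul2n -expnS (leq_trans _ dj) // dvdn_leq // pfactor_dvdnn.
rewrite /common_multiple big_ord_recr /=.
have [small|big] := leqP (p ^ logn p d) (2 ^ j).
  by apply/dvdn_mulr/IH; rewrite expn_gt0 p0.
move: pj big; case: (logn p d) => [|a]; first by rewrite dvd1n.
(* Now [p ^ a <= 2 ^ j < p ^ a.+1 <= 2 ^ j.+1], so [p] divides the last binomial coefficient. *)
move=> pj big; rewrite expnSr; apply: dvdn_mul.
  apply: IH; rewrite expn_gt0 p0 /= -leq_double (leq_trans _ pj) //.
  by rewrite expnS -mul2n leq_mul2r p1 orbT.
rewrite -{1}(expn1 p) pfactor_dvdn ?bin_gt0 -?addnn ?leq_addl // addnn.
rewrite logn_central_bin //.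
have aj : a.+1 <= (2 ^ j).*2 by rewrite (leq_trans _ pj) // ltnW // ltn_expl.
(* The term of index [a.+1] alone is at least 1: [p ^ a.+1] exceeds [2 ^ j] but not its double. *)
rewrite (bigD1_seq a.+1) ?iota_uniq ?mem_index_iota //=.
apply: leq_trans (leq_addr _ _).
by rewrite [X in _ - X.*2]divn_small // subn0 divn_gt0 ?expn_gt0 ?p0.
Qed.

(** For the least nondivisor [l], the central binomial coefficient with [n = l.-1./2] divides [x].
    The last bound says that [l] is logarithmic in [x]. *)
Lemma small_nondivisor x : 0 < x ->
  exists l, [/\ 0 < l, ~~ (l %| x) & 2 ^ l.-1./2 <= x].
Proof.
move=> x0.
have ex : exists l, (0 < l) && ~~ (l %| x).
  by exists x.+1; apply/negP => /dvdn_leq -/(_ x0); rewrite ltnn.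
case: (ex_minnP ex) => l /andP[l0 ndl] lmin; exists l; split=> //.
apply: leq_trans (central_bin_ge _) _; apply: dvdn_leq => //.
apply: central_bin_dvdn => d /andP[d0 dl].
by apply: contraT => ndd; have := lmin d; rewrite d0 ndd => /(_ isT); lia.
Qed.

End CommonMultiples.

Local Open Scope classical_set_scope.
Local Open Scope ring_scope.

(** * Index, word norm and residual finiteness growth *)

Lemma min_nat_mem (P : set nat) : (exists n, P n) -> P (min_nat P).
Proof.
case=> n Pn; rewrite /min_nat; case: pselect => [exP|[]]; last by exists n; apply/asboolP.
by case: ex_minnP => k /asboolP.
Qed.

Lemma min_nat_le (P : set nat) n : P n -> (min_nat P <= n)%N.
Proof.
move=> Pn; rewrite /min_nat; case: pselect => [exP|[]]; last by exists n; apply/asboolP.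
by case: ex_minnP => k _; apply; apply/asboolP.
Qed.

Lemma card_finType (T : finType) : ([set: T] #= `I_#|T|)%card.
Proof.
have inj : {in [set: T] &, injective (@enum_rank T)} by move=> x y _ _ /enum_rank_inj.
rewrite -(card_eql (inj_card_eq inj)) (card_eqr card_II).
suff -> : enum_rank @` [set: T] = [set: 'I_#|T|] by exact: card_eqxx.
by apply/seteqP; split=> // i _; exists (enum_val i) => //; exact: enum_valK.
Qed.

Section Subgroups.
Local Open Scope group_scope.
Variable G : groupType.
Implicit Types (S N : set G) (g : G).

Lemma subgroup1 N : is_subgroup N -> N 1. Proof. by case. Qed.

Lemma subgroupV N x : is_subgroup N -> N x -> N x^-1.
Proof. by case=> N1 NB /(NB _ _ N1); rewrite div1g. Qed.

Lemma subgroupM N x y : is_subgroup N -> N x -> N y -> N (x * y).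
Proof.
by move=> sN Nx /(subgroupV sN) Ny; have [_ NB] := sN; rewrite -[y]invgK; apply: NB.
Qed.

Lemma subgroupX N x n : is_subgroup N -> N x -> N (x ^+ n).
Proof.
move=> sN Nx; elim: n => [|n IH]; first by rewrite expg0; apply: subgroup1.
by rewrite expgS; apply: subgroupM.
Qed.

Lemma eq_left_coset N x y : is_subgroup N ->
  [set x * z | z in N] = [set y * z | z in N] <-> N (x^-1 * y).
Proof.
move=> sN; split=> [eqxy|Nxy].
  have : [set y * z | z in N] y by exists 1; rewrite ?mulg1 //; apply: subgroup1.
  by rewrite -eqxy => -[z Nz <-]; rewrite mulKg.
apply/seteqP; split=> _ [z Nz <-].
  exists ((x^-1 * y)^-1 * z); last by rewrite invgM invgK -!mulgA mulVKg.
  by apply: subgroupM => //; apply: subgroupV.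
exists (x^-1 * y * z); last by rewrite -mulgA mulVKg.
exact: subgroupM.
Qed.

(** The value of [f] at any representative determines the coset. An arbitrary function is allowed
    because the one in [quadratic_index] is not a morphism. *)
Lemma index_le (T : finType) (f : G -> T) N : is_subgroup N ->
  (forall x y, f x = f y -> N (x^-1 * y)) ->
  exists2 n, has_index N n & (n <= #|T|)%N.
Proof.
move=> sN fN.
pose coset t : set G := [set z | exists2 g, f g = t & N (g^-1 * z)].
have sub : left_cosets N `<=` coset @` [set: T].
  move=> _ [g _ <-]; exists (f g) => //; apply/seteqP; split=> [z [h fh]|_ [z Nz <-]].
    move=> Nhz; exists (g^-1 * z); last by rewrite mulVKg.
    have -> : g^-1 * z = (g^-1 * h) * (h^-1 * z) by rewrite -mulgA mulVKg.
    by apply: subgroupM => //; apply: fN.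
  by exists g => //; rewrite mulKg.
have le1 : (left_cosets N #<= [set: T])%card.
  exact: card_le_trans (subset_card_le sub) (card_image_le _ _).
have /finite_setP[n cardn] : finite_set (left_cosets N).
  exact: card_le_finite le1 finite_finset.
exists n => //.
by rewrite -card_le_II -(card_le_eql cardn) -(card_le_eqr (card_finType T)).
Qed.

Lemma index_ge (T : finType) (f : T -> G) N n : is_subgroup N ->
  (forall s t, N ((f s)^-1 * f t) -> s = t) ->
  has_index N n -> (#|T| <= n)%N.
Proof.
move=> sN fN cardn.
have finj : {in [set: T] &, injective (fun t => [set f t * x | x in N])}.
  by move=> s t _ _ /(eq_left_coset _ _ sN) /fN.
rewrite -card_le_II -(card_le_eqr cardn) -(card_le_eql (card_finType T)).
rewrite -(card_le_eql (inj_card_eq finj)); apply: subset_card_le.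
by move=> _ [t _ <-]; exists (f t).
Qed.

Lemma divisibility_le g N n : is_normal_subgroup N -> has_index N n -> ~ N g ->
  (divisibility g <= n)%N.
Proof. by move=> nN idx Ng; apply: min_nat_le; exists N. Qed.

(** The given [N] makes the set of indices nonempty, so [min_nat] does not take its default
    value. *)
Lemma divisibility_attained g N n : is_normal_subgroup N -> has_index N n -> ~ N g ->
  exists M, [/\ is_normal_subgroup M, ~ M g & has_index M (divisibility g)].
Proof.
move=> nN idx Ng.
rewrite /divisibility; set P : set nat := (X in min_nat X).
have : P (min_nat P) by apply: min_nat_mem; exists n, N.
by [].
Qed.

Definition is_word S (w : seq G) : Prop := forall x, x \in w -> S x \/ S x^-1.

Lemma is_word_cons S x w : is_word S (x :: w) <-> (S x \/ S x^-1) /\ is_word S w.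
Proof.
split=> [Sw|[Sx Sw] y].
  by split=> [|y yw]; apply: Sw; rewrite inE ?eqxx ?yw ?orbT.
by rewrite inE => /orP[/eqP->|/Sw].
Qed.

(** By minimality the subgroup generated by [S] lies in this one, so every element is the value of a
    word. *)
Lemma word_prod_subgroup S :
  is_subgroup [set g | exists2 w, is_word S w & \prod_(x <- w) x = g].
Proof.
split; first by exists [::]; rewrite ?big_nil.
move=> _ _ [u Su <-] [v Sv <-].
exists (u ++ rev [seq x^-1 | x <- v]).
  move=> x; rewrite mem_cat mem_rev => /orP[/Su//|/mapP[y /Sv Sy ->]].
  by rewrite invgK; tauto.
rewrite big_cat /=; congr (_ * _).
elim: v {Sv} => [|x v IH]; first by rewrite !big_nil invg1.
by rewrite /= rev_cons -cats1 big_cat !big_cons big_nil /= mulg1 invgM -IH.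
Qed.

Lemma word_normP S g : generates S -> exists w : seq G,
  [/\ size w = word_norm S g, is_word S w & \prod_(x <- w) x = g].
Proof.
move=> genS.
have [w Sw wg] : exists2 w, is_word S w & \prod_(x <- w) x = g.
  suff subS : S `<=` [set h | exists2 w, is_word S w & \prod_(x <- w) x = h].
    have := smallest_sub (word_prod_subgroup S) subS.
    by rewrite genS; apply.
  move=> x Sx; exists [:: x]; last by rewrite big_seq1.
  by move=> y; rewrite inE => /eqP ->; left.
rewrite /word_norm; set P : set nat := (X in min_nat X).
have : P (min_nat P) by apply: min_nat_mem; exists (size w), w.
by [].
Qed.

Lemma word_norm_le S w : is_word S w -> (word_norm S (\prod_(x <- w) x) <= size w)%N.
Proof. by move=> Sw; apply: min_nat_le; exists w. Qed.

Lemma word_norm1 S : word_norm S 1 = 0%N.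
Proof.
apply/eqP; rewrite -leqn0.
have -> : (1 : G) = \prod_(x <- [::]) x by rewrite big_nil.
exact: (@word_norm_le S [::]).
Qed.

Lemma word_normM S x y : generates S ->
  (word_norm S (x * y) <= word_norm S x + word_norm S y)%N.
Proof.
move=> genS; have [u [<- Su <-]] := word_normP x genS.
have [v [<- Sv <-]] := word_normP y genS.
rewrite -big_cat -size_cat; apply: word_norm_le => z.
by rewrite mem_cat => /orP[/Su|/Sv].
Qed.

Lemma word_normX S x n : generates S -> (word_norm S (x ^+ n) <= n * word_norm S x)%N.
Proof.
move=> genS; elim: n => [|n IH]; first by rewrite expg0 word_norm1.
by rewrite expgS mulSn; apply: leq_trans (word_normM _ _ genS) _; rewrite leq_add2l.
Qed.

Lemma finite_word_ball S n : finite_generating S ->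
  finite_set [set g | (word_norm S g <= n)%N].
Proof.
move=> [finS genS].
pose L := S `|` [set x^-1 | x in S].
have finL : finite_set L by rewrite finite_setU; split=> //; apply: finite_image.
pose W k := [set g | exists w, [/\ size w = k, is_word S w & \prod_(x <- w) x = g]].
have finW k : finite_set (W k).
  elim: k => [|k IH].
    apply: sub_finite_set (finite_set1 (1 : G)) => g [w [/size0nil -> _ <-]].
    by rewrite big_nil.
  apply: sub_finite_set (finite_image2 (fun x y => x * y) finL IH) => g [[|x w] [//= [sz]]].
  move=> /is_word_cons[Sx Sw]; rewrite big_cons => <-.
  exists x; last by exists (\prod_(y <- w) y) => //; exists w.
  by case: Sx => [|Sx]; [left|right; exists x^-1; rewrite ?invgK].
apply: sub_finite_set (bigcup_finite (finite_II n.+1) (fun k _ => finW k)).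
by move=> g /= gn; exists (word_norm S g) => //; exact: word_normP.
Qed.

End Subgroups.

Section RFBounds.
Variables (R : realType) (G : groupType).
Implicit Types (S : set G) (r b : R).

Lemma RF_ge S r g : finite_generating S -> g != 1%g ->
  (word_norm S g)%:R <= r -> (divisibility g)%:R <= RF S r.
Proof.
move=> genS g1 gr; rewrite ler_nat; set P := [set _ | _].
have [->//|d0] := posnP (divisibility g).
(* The maximum runs over the support of [divisibility] in [P], and would be 0 by default if that
   support were infinite. *)
have finP : finite_set (P `&` divisibility (G:=G) @^-1` [set~ 0%N]).
  apply: sub_finite_set (finite_word_ball (Num.truncn r) genS) => h [[hr _] _] /=.
  by rewrite truncn_ge_nat // (le_trans _ hr).
apply: (@leq_bigmax_seq _ (finite_support _ _ _) _ _ g) => //.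
by rewrite in_finite_support // inE; split=> //= d; rewrite d in d0.
Qed.

Lemma RF_le S r b : 0 <= b ->
  (forall g, g != 1%g -> (word_norm S g)%:R <= r -> (divisibility g)%:R <= b) ->
  RF S r <= b.
Proof.
move=> b0 db; rewrite /RF; set P := [set _ | _].
rewrite big_seq; elim/big_ind: _ => //= [x y xb yb|g].
  by rewrite /maxn; case: ifP.
by case: finite_supportP => // X XP _ _ /XP[gr g1]; apply: db.
Qed.

End RFBounds.

(** * Integer matrices: rank and skew-symmetry *)

Lemma clear_denominators m n (B : 'M[rat]_(m, n)) :
  exists2 e, (0 < e)%N & exists C : 'M[int]_(m, n), e%:R *: B = map_mx intr C.
Proof.
pose d i j := `|denq (B i j)|%N.
pose e := (\prod_i \prod_j d i j)%N.
exists e; first by apply: prodn_gt0 => i; apply: prodn_gt0 => j; rewrite absz_gt0 denq_neq0.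
exists (\matrix_(i, j) numq (e%:R * B i j)); apply/matrixP => i j; rewrite !mxE.
apply/esym/numqK.
rewrite /e (bigD1 i) //= (bigD1 j) //= -mulnA natrM mulrAC rpredM ?natr_int //.
have -> : (d i j)%:R = (denq (B i j))%:~R :> rat by rewrite /d pmulrn absz_denq.
by rewrite mulrC -numqE intr_int.
Qed.

Lemma inj_map_mx (aT rT : Type) (f : aT -> rT) m n :
  injective f -> injective (map_mx f : 'M[aT]_(m, n) -> 'M[rT]_(m, n)).
Proof.
move=> finj B C /matrixP eqBC; apply/matrixP => i j; apply: finj.
by have := eqBC i j; rewrite !mxE.
Qed.

(** [P] selects a maximal family of rows of [A] independent over the rationals; the last clause is
    their independence. *)
Lemma rank_factorization m (A : 'M[int]_m) (k := int_rank A) :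
  exists (P : 'M[int]_(k, m)) (M : 'M[int]_(m, k)) (e : nat),
  [/\ (0 < e)%N, e%:R *: A = M *m (P *m A)
    & forall y : 'rV[int]_k, y *m (P *m A) = 0 -> y = 0].
Proof.
pose AQ := map_mx (intr : int -> rat) A; pose f := maxrankfun AQ.
pose P : 'M[int]_(k, m) := rowsub f 1%:M.
have PA : P *m A = rowsub f A by rewrite /P -rowsubE.
have PAQ : map_mx intr (P *m A) = rowsub f AQ by rewrite PA map_mxsub.
(* The selected rows span the row space, so this matrix of rational coefficients expresses all rows
   of [AQ] in them. *)
have [e e0 [M eM]] := clear_denominators (AQ *m pinvmx (rowsub f AQ)).
exists P, M, e; split=> // [|y yPA].
  apply: (inj_map_mx (intr_inj : injective (intr : int -> rat))).
  rewrite map_mxM PAQ -eM map_mxZ rmorph_nat -scalemxAl mulmxKpV //.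
  by rewrite eq_maxrowsub.
apply: (inj_map_mx (intr_inj : injective (intr : int -> rat))).
apply: (row_free_inj (maxrowsub_free AQ)).
by rewrite -PAQ -map_mxM yPA !map_mx0 mul0mx.
Qed.

(** A skew-symmetric matrix is its lower part minus the transpose of that part. Hence [phi], the
    antisymmetrized cocycle, describes commutators. *)
Lemma lower_part_alt m (A : 'M[int]_m) u v : A^T = - A ->
  matrix_form (lower_part A) u v - matrix_form (lower_part A) v u =
  matrix_form A u v.
Proof.
move=> alt.
set L := lower_part A.
have trL : matrix_form L v u = (u^T *m L^T *m v) 0 0.
  have -> : u^T *m L^T *m v = (v^T *m L *m u)^T by rewrite !trmx_mul trmxK mulmxA.
  by rewrite [RHS]mxE.
rewrite trL /matrix_form.
have -> (B C : 'M[int]_1) : B 0 0 - C 0 0 = (B - C) 0 0 by rewrite !mxE.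
rewrite -mulmxBl -mulmxBr.
congr ((_ *m _ *m _) 0 0); apply/matrixP => i j; rewrite !mxE.
have : (A^T) i j = (- A) i j by rewrite alt.
rewrite !mxE => Aji.
case: ltngtP => ij; first by rewrite subr0.
  by rewrite sub0r Aji opprK.
have eij : i = j by apply: val_inj.
by subst j; move: (A i i) Aji => a; lia.
Qed.

Lemma matrix_form_alt m (A : 'M[int]_m) u v : A^T = - A ->
  matrix_form A u v = - matrix_form A v u.
Proof. by move=> alt; rewrite -!(lower_part_alt _ _ alt) opprB. Qed.

(** * The group of an alternating form *)

Section Coordinates.
Variables (m : nat) (A : 'M[int]_m).
Hypothesis alt : A^T = - A.
Local Notation phiL := (matrix_form (lower_part A)).
Local Notation phi := (matrix_form A).
Implicit Types x y g : Gphi A.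

Definition gw x := (gpair x).1.
Definition gv x := (gpair x).2.

Lemma Gphi_eq x y : gw x = gw y -> gv x = gv y -> x = y.
Proof. by case: x y => [[? ?]] [[? ?]]; rewrite /gw /gv /= => -> ->. Qed.

Lemma gw1 : gw 1%g = 0. Proof. by []. Qed.
Lemma gv1 : gv 1%g = 0. Proof. by []. Qed.

Lemma gwM x y : gw (x * y)%g = gw x + gw y.
Proof. by case: x y => [[? ?]] [[? ?]]. Qed.

Lemma gvM x y : gv (x * y)%g = gv x + gv y + phiL (gw x) (gw y).
Proof. by case: x y => [[? ?]] [[? ?]]. Qed.

Lemma gwV x : gw x^-1%g = - gw x.
Proof. by case: x => [[? ?]]. Qed.

Lemma gvV x : gv x^-1%g = - gv x + phiL (gw x) (gw x).
Proof. by case: x => [[? ?]]. Qed.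

Lemma gwJ x g : gw (x ^ g)%g = gw x.
Proof. by rewrite /conjg !gwM gwV addrC -addrA subrr addr0. Qed.

Lemma gvJ x g : gv (x ^ g)%g = gv x + phi (gw x) (gw g).
Proof.
rewrite /conjg -(lower_part_alt _ _ alt) !gvM gwV gwM gvV.
rewrite matrix_formNl matrix_formDr; ring.
Qed.

(** Twice the central coordinate, corrected so that the defect of additivity is the alternating
    [phi] instead of [phiL]. *)
Definition quad x := 2 * gv x - phiL (gw x) (gw x).

Lemma quadM x y : quad (x * y)%g = quad x + quad y + phi (gw x) (gw y).
Proof.
rewrite /quad gvM gwM -(lower_part_alt _ _ alt) !matrix_formDl !matrix_formDr; ring.
Qed.

Lemma quadV x : quad x^-1%g = - quad x.
Proof. rewrite /quad gvV gwV matrix_formNl matrix_formNr; ring. Qed.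

Lemma quadJ x g : quad (x ^ g)%g = quad x + 2 * phi (gw x) (gw g).
Proof. rewrite /quad gvJ gwJ; ring. Qed.

End Coordinates.

(** * Normal subgroups of finite index *)

Definition residue (q : nat) (a : int) : 'I_q.-1.+1 := inord `|(a %% q)%Z|%N.

Lemma residue_eq q a b : (0 < q)%N -> residue q a = residue q b -> (q %| b - a)%Z.
Proof.
move=> q0 /(congr1 val); have q0' : q%:Z != 0 by lia.
have small c : (`|(c %% q)%Z| < q.-1.+1)%N.
  by rewrite prednK // -ltz_nat gez0_abs ?modz_ge0 // ltz_pmod.
rewrite /= !inordK // => eqab; rewrite -eqz_mod_dvd; apply/eqP.
by rewrite -[LHS]gez0_abs ?modz_ge0 // -eqab gez0_abs ?modz_ge0.
Qed.

Section FiniteIndexSubgroups.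
Variables (m : nat) (A : 'M[int]_m).
Hypothesis alt : A^T = - A.
Local Notation phi := (matrix_form A).
Implicit Types x y g : Gphi A.

Lemma coordinate_index (i : 'I_m) (l : nat) (N := [set x : Gphi A | (l %| gw x i 0%R)%Z]) :
  (0 < l)%N ->
  is_normal_subgroup N /\ exists2 n, has_index N n & (n <= l)%N.
Proof.
move=> l0; have sN : is_subgroup N.
  split=> [|x y]; rewrite /N /= ?gw1 ?mxE ?dvdz0 //.
  by rewrite gwM gwV !mxE => lx ly; exact: rpredB.
split; first by split=> // x g; rewrite /N /= gwJ.
have [x y|n idx] := @index_le _ _ (fun x => residue l (gw x i 0)) N sN.
  by move=> /(residue_eq l0); rewrite /N /= gwM gwV !mxE addrC.
by rewrite card_ord prednK // => nl; exists n.
Qed.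

(** Working modulo [l * e] leaves [A *m gw x] divisible by [l] after cancelling [e]. So [phi]
    vanishes modulo [l] against such [x], which makes [quad] additive and conjugation invariant
    there. *)
Lemma quadratic_index k (M : 'M[int]_(m, k)) (U : 'M[int]_(k, m)) (e l : nat)
    (N := [set x : Gphi A | (forall i, ((l * e)%N %| (U *m gw x)%R i 0%R)%Z) /\ (l %| quad x)%Z]) :
  (0 < e)%N -> (0 < l)%N -> e%:R *: A = M *m U ->
  is_normal_subgroup N /\ exists2 n, has_index N n & (n <= (l * e) ^ k * l)%N.
Proof.
move=> e0 l0 eA.
have q0 : (0 < l * e)%N by rewrite muln_gt0 l0.
pose H : set (Gphi A) := [set x | forall i, ((l * e)%N %| (U *m gw x)%R i 0%R)%Z].
have phiH w x : H x -> (l %| phi w (gw x))%Z.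
  move=> Hx.
  have Ax i : (l %| (A *m gw x)%R i 0%R)%Z.
    have : ((l * e)%N %| e%:R * (A *m gw x)%R i 0%R)%Z.
      have -> : e%:R * (A *m gw x)%R i 0 = (M *m (U *m gw x)%R) i 0.
        by rewrite mulmxA -eA -scalemxAl [RHS]mxE.
      by rewrite mxE; apply: rpred_sum => j _; apply: dvdz_mull.
    by rewrite PoszM mulrC natz dvdz_mul2r ?gt_eqF ?ltz_nat ?e0 //.
  rewrite /matrix_form -mulmxA mxE.
  by apply: rpred_sum => j _; apply: dvdz_mull.
have sN : is_subgroup N.
  split=> [|x y [Hx qx] [Hy qy]].
    by split=> [i|]; rewrite ?gw1 ?mulmx0 ?mxE ?dvdz0 // /quad gv1 gw1 matrix_form0l.
  split=> [i|].
    rewrite gwM gwV mulmxDr mulmxN !mxE.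
    by rewrite rpredB //; [have := Hx i|have := Hy i]; rewrite mxE.
  rewrite quadM // quadV gwV matrix_formNr.
  apply: rpredD; first exact: rpredB.
  by rewrite rpredN; exact: phiH.
split.
  split=> // x g [Hx qx]; split=> [i|]; first by rewrite gwJ.
  rewrite quadJ // rpredD // dvdz_mull // matrix_form_alt // rpredN phiH //.
pose r x : {ffun 'I_k -> 'I_(l * e).-1.+1} := [ffun i => residue (l * e) ((U *m gw x)%R i 0)].
have rH x y : r x = r y -> H (x^-1 * y)%g.
  move=> /ffunP rxy i; have := rxy i; rewrite !ffunE => /(residue_eq q0).
  by rewrite gwM gwV mulmxDr mulmxN !mxE [in X in _ -> X]addrC.
(* [quad] is a morphism modulo [l] only on [H], so it is evaluated on [t^-1 x], where [t] is a
   fixed representative of the coset [x H]. *)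
pose t c := xget (1%g : Gphi A) [set x | r x = c].
have tr x : r (t (r x)) = r x.
  by apply: (@xgetPex _ 1%g [set y | r y = r x]); exists x.
pose f x := (r x, residue l (quad ((t (r x))^-1 * x)%g)).
have [x y [rxy]|n idx] := @index_le _ _ f N sN; last first.
  by rewrite card_prod card_ffun !card_ord !prednK // => nl; exists n.
rewrite -rxy => /(residue_eq l0).
set z := t (r x) => qxy; split; first exact: rH.
have Hz u : r u = r x -> H (z^-1 * u)%g by move=> ru; apply: rH; rewrite tr.
(* Both factors come from elements of [H], where [quad] is additive modulo [l]. *)
have -> : (x^-1 * y = (z^-1 * x)^-1 * (z^-1 * y))%g.
  by rewrite invgM invgK -!mulgA mulVKg.
rewrite quadM // quadV; apply: rpredD; last exact: (phiH _ _ (Hz y (esym rxy))).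
by rewrite addrC.
Qed.

End FiniteIndexSubgroups.

(** * Sizes of elements and bounds on indices *)

Definition col_size m (w : 'cV[int]_m) : nat := (\sum_i `|w i 0%R|)%N.

Lemma col_sizeD m (u v : 'cV[int]_m) : (col_size (u + v) <= col_size u + col_size v)%N.
Proof.
rewrite -big_split; apply: leq_sum => i _ /=; rewrite mxE.
by move: (u i 0) (v i 0) => a b; lia.
Qed.

Lemma col_size_entry m (w : 'cV[int]_m) i : (`|w i 0%R| <= col_size w)%N.
Proof. by rewrite /col_size (bigD1 i) //= leq_addr. Qed.

Lemma absz_sum (I : finType) (F : I -> int) : (`|(\sum_i F i)%R| <= \sum_i `|F i|)%N.
Proof.
elim/big_rec2: _ => // i n a _ IH; apply: leq_trans (_ : `|F i| + `|a| <= _)%N; lia.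
Qed.

Lemma matrix_form_bound m (B : 'M[int]_m) u v :
  (`|matrix_form B u v| <= (\sum_i \sum_j `|B i j|) * col_size u * col_size v)%N.
Proof.
rewrite /matrix_form mxE; apply: leq_trans (absz_sum _) _.
rewrite exchange_big !big_distrl /=; apply: leq_sum => j _.
rewrite abszM leq_mul ?col_size_entry // mxE; apply: leq_trans (absz_sum _) _.
rewrite big_distrl /=; apply: leq_sum => i _.
by rewrite abszM mulnC leq_mul // mxE col_size_entry.
Qed.

Lemma finite_set_bound (T : eqType) (S : set T) (F : T -> nat) : finite_set S ->
  exists B, forall x, S x -> (F x <= B)%N.
Proof.
move=> /finite_seqP[s ->]; exists (\max_(x <- s) F x)%N => x xs.
exact: leq_bigmax_seq.
Qed.

Section IndexEstimates.
Variables (m : nat) (A : 'M[int]_m).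
Local Notation phiL := (matrix_form (lower_part A)).
Local Notation phi := (matrix_form A).
Implicit Types x y g : Gphi A.

Definition gsize g := (col_size (gw g) + `|gv g|)%N.

(** Along a word [w] grows linearly, so each further letter changes the central coordinate by a
    linear amount through [phiL], and the total is quadratic. *)
Lemma gsize_word_norm (S : set (Gphi A)) : finite_generating S ->
  exists c, forall g, (gsize g <= c * word_norm S g ^ 2)%N.
Proof.
move=> [finS genS].
have [B1 B1P] := finite_set_bound gsize finS.
have [B2 B2P] := finite_set_bound (fun x => gsize x^-1%g) finS.
pose B := (B1 + B2)%N.
have BP x : S x \/ S x^-1%g -> (gsize x <= B)%N.
  by case=> [/B1P|/B2P]; rewrite ?invgK /B; lia.
pose a := (\sum_i \sum_j `|lower_part A i j|)%N.
pose c := (B + a * B ^ 2)%N.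
have bound w : is_word S w -> let p := (\prod_(x <- w) x)%g in
    (col_size (gw p) <= B * size w)%N /\ (`|gv p| <= c * size w ^ 2)%N.
  elim: w => [_|x w IH] /=.
    rewrite big_nil gw1 gv1; split=> //.
    by rewrite /col_size big1 // => i _; rewrite mxE.
  move=> /is_word_cons[/BP]; rewrite /gsize => xB /IH[]; rewrite big_cons.
  set p := (\prod_(x <- w) x)%g => pw pv; rewrite gwM gvM.
  have wD := col_sizeD (gw x) (gw p).
  have := matrix_form_bound (lower_part A) (gw x) (gw p); rewrite -/a => fb.
  split; first by rewrite mulnS (leq_trans wD) // leq_add // (leq_trans (leq_addr _ _) xB).
  have {}fb : (`|phiL (gw x) (gw p)| <= a * B ^ 2 * size w)%N.
    apply: leq_trans fb _.
    have -> : (a * B ^ 2 * size w = (a * B) * (B * size w))%N by ring.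
    by rewrite leq_mul // leq_mul // (leq_trans _ xB) // leq_addr.
  apply: leq_trans (_ : B + c * size w ^ 2 + a * B ^ 2 * size w <= _)%N.
    move: (leq_trans (leq_addl _ _) xB) pv fb.
    by move: (gv x) (gv p) (phiL _ _) (c * _)%N (a * _ * _)%N => ? ? ? ? ?; lia.
  rewrite /c; move: (size w) (a * B ^ 2)%N => n d; nia.
exists (B + c)%N => g.
have [w [<- Sw <-]] := word_normP g genS.
have [bw bv] := bound w Sw; rewrite /gsize mulnDl leq_add //.
by apply: leq_trans bw _; rewrite leq_mul2l; nia.
Qed.

Lemma eq_Gphi1 g : gw g = 0 -> gv g = 0 -> g = 1%g.
Proof. by move=> w0 v0; apply: Gphi_eq. Qed.

Hypothesis alt : A^T = - A.

Lemma Gphi_commutator x g :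
  MkGphi A (0, phi (gw x) (gw g)) = (x^-1 * x ^ g)%g.
Proof.
apply: Gphi_eq; first by rewrite gwM gwV gwJ addNr.
rewrite gvM gvV gvJ // gwV gwJ matrix_formNl /gv /=; ring.
Qed.

(** A nonzero coordinate of [w] already gives index at most [l]; otherwise [quad g] is [2 * gv g].
    The larger index bound covers both cases. *)
Lemma separating_subgroup k e (M : 'M[int]_(m, k)) (U : 'M[int]_(k, m)) g :
  (0 < e)%N -> e%:R *: A = M *m U -> g != 1%g -> exists l N n,
  [/\ (0 < l)%N, (2 ^ l.-1./2 <= 2 * gsize g)%N, is_normal_subgroup N /\ has_index N n,
      ~ N g & (n <= (l * e) ^ k * l)%N].
Proof.
move=> e0 eA g1; have [[i wi]|w0] := pselect (exists i, gw g i 0 != 0).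
  have [|l [l0 ndl le2]] := @small_nondivisor `|gw g i 0%R|%N; first by rewrite absz_gt0.
  have [nN [n idx nl]] := coordinate_index A i l0.
  exists l, [set x | (l %| gw x i 0%R)%Z], n; split=> //.
  - by apply: leq_trans le2 _; have := col_size_entry (gw g) i; rewrite /gsize; lia.
  - by rewrite /= dvdzE; apply/negP.
  by rewrite (leq_trans nl) // leq_pmull // expn_gt0 muln_gt0 l0 e0.
have {}w0 : gw g = 0.
  apply/colP => i; rewrite mxE; apply: contrapT => /eqP wi; by apply: w0; exists i.
have [|l [l0 ndl le2]] := @small_nondivisor `|(2 * gv g)%R|%N.
  rewrite absz_gt0 mulf_neq0 //; apply: contraNneq g1 => v0; exact/eqP/eq_Gphi1.
have [nN [n idx nl]] := quadratic_index alt e0 l0 eA.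
exists l; eexists; exists n; split; [by []| |by split; [exact: nN|]| |by []].
  by apply: leq_trans le2 _; rewrite abszM /gsize; lia.
by case=> _; rewrite /quad w0 matrix_form0l subr0 dvdzE; apply/negP.
Qed.

(** The points [f c] of a box lie in distinct cosets: a quotient lying in [N] has its commutators in
    [N], which are short central elements, hence trivial. *)
Lemma index_lower k (P : 'M[int]_(k, m)) N n Q :
  (forall y : 'rV[int]_k, y *m (P *m A) = 0 -> y = 0) ->
  is_normal_subgroup N -> has_index N n ->
  (forall s, (0 < s <= Q)%N -> ~ N (MkGphi A (0, s%:Z))) ->
  (Q ^ k.+1 <= n * (\sum_j \sum_i `|(P *m A) j i|).+1 ^ k)%N.
Proof.
move=> freeU [sN normN] idx sepN; set a := (\sum_(j < k) _)%N.+1; set U := P *m A in freeU *.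
have sep s : (`|s| <= Q)%N -> N (MkGphi A (0, s)) -> s = 0.
  move=> sQ Ns; apply/eqP; rewrite -absz_eq0 -leqn0 leqNgt; apply/negP => s0.
  apply: (@sepN `|s|%N); first by rewrite s0.
  have [s_ge|s_lt] := leP 0 s; first by rewrite gez0_abs.
  have -> : MkGphi A (0, `|s|%N%:Z) = (MkGphi A (0, s))^-1%g.
    apply: Gphi_eq; first by rewrite gwV /gw /= oppr0.
    by rewrite gvV /gv /gw /= matrix_form0l addr0 ltz0_abs.
  exact: subgroupV.
(* Each column of [U] has absolute sum below [a], so differences of coefficients below [t] give
   entries of size at most [Q]. Since [Q <= a * t], only the factor [a ^ k] is lost. *)
pose t := (Q %/ a).+1.
pose y (c : {ffun 'I_k -> 'I_t}) : 'rV[int]_k := \row_j (c j)%:Z.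
pose f (c : {ffun 'I_k -> 'I_t} * 'I_Q.+1) := MkGphi A ((y c.1 *m P)^T, (c.2)%:Z).
have finj c d : N ((f c)^-1 * f d)%g -> c = d.
  move=> Ncd; set x := ((f c)^-1 * f d)%g in Ncd.
  have gwx : gw x = ((y d.1 - y c.1) *m P)^T.
    by rewrite /x gwM gwV /f /gw /= mulmxBl linearB /= addrC.
  have phix i : phi (gw x) (delta_mx i 0) = ((y d.1 - y c.1) *m U) 0 i.
    by rewrite /matrix_form gwx trmxK -[X in X *m delta_mx _ _]mulmxA -/U -colE mxE.
  (* The entries are the central coordinates of the commutators of [x] with the basis vectors. *)
  have y0 : (y d.1 - y c.1) *m U = 0.
    apply/rowP => i; rewrite [RHS]mxE -phix; apply: sep.
      rewrite phix mxE; apply: leq_trans (absz_sum _) _.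
      apply: leq_trans (_ : \sum_j (Q %/ a) * `|U j i| <= _)%N.
        apply: leq_sum => j _; rewrite abszM leq_mul2r; apply/orP; right.
        rewrite !mxE; have := ltn_ord (c.1 j); have := ltn_ord (d.1 j); rewrite /t; lia.
      rewrite -big_distrr /=; apply: leq_trans (leq_divM Q a); rewrite leq_mul2l.
      apply/orP; right; rewrite /a ltnW // ltnS; apply: leq_sum => j _.
      by rewrite (bigD1 i) //= leq_addr.
    rewrite (Gphi_commutator x (MkGphi A (delta_mx i 0, 0))).
    by apply: subgroupM => //; [apply: subgroupV|apply: normN].
  have yy : y c.1 = y d.1 by apply/esym/subr0_eq/freeU.
  have eq1 : c.1 = d.1.
    apply/ffunP => j; apply: val_inj; have := congr1 (fun z : 'rV_k => z 0 j) yy.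
    by rewrite !mxE => -[].
  have : (d.2)%:Z - (c.2)%:Z = 0.
    apply: sep; first by have := ltn_ord c.2; have := ltn_ord d.2; lia.
    suff <- : x = MkGphi A (0, (d.2)%:Z - (c.2)%:Z) by [].
    apply: Gphi_eq; first by rewrite gwx yy subrr mul0mx trmx0.
    rewrite /x gvM gvV gwV /f /gw /gv /= yy matrix_formNl; ring.
  move=> eq2; case: c d eq1 eq2 {Ncd x gwx phix y0 yy} => [c1 c2] [d1 d2] /= -> eq2.
  by congr (_, _); apply: val_inj => /=; lia.
have := index_ge sN finj idx; rewrite card_prod card_ffun !card_ord => tn.
have Qat : (Q <= a * t)%N by rewrite ltnW // mulnC ltn_ceil.
apply: leq_trans (leq_mul tn (leqnn (a ^ k))).
rewrite mulnAC -expnMn expnSr; apply: leq_mul; last exact: leqnSn.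
rewrite mulnC; have [->|k0] := posnP k; first by rewrite !expn0.
by rewrite leq_exp2r.
Qed.

End IndexEstimates.

(** * The growth estimates *)

Section Growth.
Variables (m : nat) (A : 'M[int]_m).
Implicit Types x y g : Gphi A.

Lemma centerX (s : int) n : (MkGphi A (0, s) ^+ n)%g = MkGphi A (0, s *+ n).
Proof.
elim: n => [|n IH]; first by rewrite expg0 mulr0n.
rewrite expgS IH; apply: Gphi_eq; first by rewrite gwM /gw /= addr0.
by rewrite gvM /gv /gw /= matrix_form0l addr0 mulrS.
Qed.

Lemma Gphi_finitely_generated : finitely_generated (Gphi A).
Proof.
pose S : set (Gphi A) :=
  [set MkGphi A (delta_mx i 0, 0) | i in [set: 'I_m]] `|` [set MkGphi A (0, 1)].
exists S; split.
  by rewrite finite_setU; split; [apply: finite_image; exact: finite_finset|exact: finite_set1].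
rewrite /generates -subTset => g _ H [sH SH].
have Hcenter v : H (MkGphi A (0, v)).
  have Hn (n : nat) : H (MkGphi A (0, n%:Z)).
    by rewrite -[n%:Z]natz -centerX; apply: subgroupX => //; apply: SH; right.
  case: v => n; first exact: Hn.
  have -> : MkGphi A (0, Negz n) = (MkGphi A (0, n.+1%:Z))^-1%g.
    apply: Gphi_eq; first by rewrite gwV /gw /= oppr0.
    by rewrite gvV /gv /gw /= matrix_form0l addr0.
  exact: subgroupV.
(* The projection of [H] is a subgroup containing the basis vectors, hence everything; [Hcenter]
   then corrects the central coordinate. *)
pose W := [set w : 'cV[int]_m | exists v, H (MkGphi A (w, v))].
have W0 : W 0 by exists 0.
have WD u w : W u -> W w -> W (u + w).
  by case=> a Ha [b Hb]; eexists; exact: subgroupM sH Ha Hb.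
have WN u : W u -> W (- u) by case=> a Ha; eexists; exact: subgroupV sH Ha.
have WX u (n : nat) : W u -> W (u *+ n).
  by move=> Wu; elim: n => [|n IH]; rewrite ?mulr0n // mulrS; apply: WD.
have Wg : W (gw g).
  rewrite [gw g]matrix_sum_delta; elim/big_ind: _ => // i _.
  rewrite big_ord_recl big_ord0 addr0.
  have Wi : W (delta_mx i 0).
    by exists 0; apply: SH; left; exists i.
  have -> : ord0 = 0 :> 'I_1 by [].
  case: (gw g i 0) => n; first by rewrite -[Posz n]natz scaler_nat; apply: WX.
  by rewrite NegzE scaleNr -[Posz _]natz scaler_nat; apply/WN/WX.
have [v Hv] := Wg.
have -> : g = (MkGphi A (gw g, v) * MkGphi A (0, gv g - v))%g.
  apply: Gphi_eq; first by rewrite gwM [X in _ + X]/gw /= addr0.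
  rewrite gvM /= matrix_form0r addr0 /gv /=; ring.
exact: subgroupM.
Qed.

Hypothesis alt : A^T = - A.

Lemma Gphi_residually_finite : residually_finite (Gphi A).
Proof.
move=> g g1; have [P [M [e [e0 eA _]]]] := rank_factorization A.
have [l [N [n [_ _ [nN idx] Ng _]]]] := separating_subgroup alt e0 eA g1.
by exists N; split=> //; exists n.
Qed.

Variable R : realType.

Lemma ln_exp (x : R) n : 0 < x -> ln (x ^+ n) = n%:R * ln x.
Proof. by move=> x0; rewrite lnXn // mulr_natl. Qed.

Lemma RF_upper (S : set (Gphi A)) : finite_generating S ->
  growth_le (RF S) (@log_pow R (int_rank A).+1).
Proof.
move=> genS; have [P [M [e [e0 eA _]]]] := rank_factorization A.
set k := int_rank A in P M eA *.
have [c sizec] := gsize_word_norm genS.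
have ln2 : 0 < ln 2 :> R by rewrite ln_gt0 // ltr1n.
(* From [2 ^ l.-1./2 <= (C r)^2] one gets [l <= 4 ln (C r) / ln 2 + 2], and [C r >= 4] absorbs the 2
   into a fifth multiple of [ln (C r) / ln 2]. *)
pose D : R := 5 / ln 2.
have D0 : 0 < D by rewrite divr_gt0.
pose E : R := e%:R ^+ k * D ^+ k.+1.
have E0 : 0 <= E by rewrite mulr_ge0 // exprn_ge0 // ltW.
(* The first summand gives [2 c r^2 <= (C r)^2], the second [4 <= C r]. *)
pose c1 : R := 2 * c%:R + 4.
have c14 : 4 <= c1 by rewrite lerDr mulr_ge0.
exists (c1 + E) => [|r]; first by rewrite ltr_wpDr //; lra.
rewrite ge_max => /andP[r1 _]; set C := c1 + E.
have r0 : 0 < r by lra.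
have Cr4 : 4 <= C * r by rewrite /C; nra.
have y2 : 2 * ln 2 <= ln (C * r).
  have -> : 2 * ln 2 = ln (2 ^+ 2) :> R by rewrite ln_exp.
  by rewrite ler_ln ?posrE ?exprn_gt0 //; lra.
apply: RF_le => [|g g1 gr]; first by rewrite /log_pow mulr_ge0 ?exprn_ge0 // ?/C; lra.
have [l [N [n [l0 le2 [nN idx] Ng nl]]]] := separating_subgroup alt e0 eA g1.
apply: (@le_trans _ _ (((l * e) ^ k * l)%N%:R)).
  by rewrite ler_nat (leq_trans _ nl) // (divisibility_le nN idx Ng).
have le2R : 2 ^+ l.-1./2 <= (C * r) ^+ 2 :> R.
  apply: (@le_trans _ _ (2 * (c%:R * r ^+ 2))).
    rewrite -natrX (le_trans (y := (2 * (c * word_norm S g ^ 2))%N%:R)) //.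
      by rewrite ler_nat (leq_trans le2) // leq_mul2l sizec.
    rewrite !natrM -expr2 ler_wpM2l // ler_wpM2l // lerXn2r ?nnegrE //; lra.
  have c0 : 0 <= c%:R :> R by [].
  rewrite exprMn mulrA ler_wpM2r ?exprn_ge0 //; [lra|].
  by rewrite /C /c1; nra.
have lD : l%:R <= D * ln (C * r).
  have : l.-1./2%:R * ln 2 <= 2 * ln (C * r).
    have : ln (2 ^+ l.-1./2) <= ln ((C * r) ^+ 2) by rewrite ler_ln ?posrE ?exprn_gt0 //; lra.
    by rewrite !ln_exp //; lra.
  have : l%:R <= 2 * l.-1./2%:R + 2 :> R.
    rewrite -(natrM _ 2) -natrD ler_nat; lia.
  move=> l2 t2; rewrite /D mulrAC ler_pdivlMr //; nra.
have -> : ((l * e) ^ k * l)%N%:R = e%:R ^+ k * l%:R ^+ k.+1 :> R.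
  by rewrite natrM natrX natrM exprMn exprSr [LHS]mulrAC [LHS]mulrC.
rewrite /log_pow; apply: (@le_trans _ _ (E * ln (C * r) ^+ k.+1)).
  rewrite /E -mulrA -exprMn ler_wpM2l ?exprn_ge0 //.
  by rewrite lerXn2r ?nnegrE // (le_trans _ lD).
have y0 : 0 <= ln (C * r) by apply: le_trans y2; rewrite mulr_ge0 // ltW.
by rewrite ler_wpM2r ?exprn_ge0 // lerDr (le_trans _ c14).
Qed.

(** Fixes [Q = 2 ^ j] comparable to [log r]; the factor 4 makes [j = 0] satisfy the left inequality
    for every [r >= 1]. *)
Lemma exists_scale (r : R) : 1 <= r ->
  exists j, 4 ^+ (2 ^ j) <= 4 * r < 4 ^+ (2 ^ j.+1).
Proof.
move=> r1.
have ex : exists j, 4 * r < 4 ^+ (2 ^ j.+1).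
  exists (Num.truncn (4 * r)); apply: lt_le_trans (truncnS_gt _) _.
  rewrite -natrX ler_nat; set n := (Num.truncn _).+1.
  by rewrite (leq_trans (ltnW (ltn_expl n (ltnSn 1)))) // ltnW // ltn_expl.
have [j jr jmin] := ex_minnP ex; exists j; rewrite jr andbT.
case: j {jr} jmin => [_|j jmin]; first by rewrite expn0 expr1; lra.
by rewrite leNgt; apply/negP => /jmin; rewrite ltnn.
Qed.

Lemma RF_lower (S : set (Gphi A)) : finite_generating S ->
  growth_le (@log_pow R (int_rank A).+1) (RF S).
Proof.
move=> genS; have [P [M [e [e0 eA free]]]] := rank_factorization A.
set k := int_rank A in P M eA free *.
pose c := word_norm S (MkGphi A (0, 1)).
pose a := (\sum_j \sum_i `|(P *m A) j i|).+1.
pose D : R := 2 * ln 4.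
have D0 : 0 <= D by rewrite mulr_ge0 // ln_ge0 // ler1n.
pose E : R := D ^+ k.+1 * a%:R ^+ k.
have E0 : 0 <= E by rewrite mulr_ge0 // exprn_ge0.
(* [4 * c] bounds the word norm of [g], a power with exponent at most [4 r] of a central element of
   norm [c]; [E] converts [Q ^ k.+1] into [ln r ^+ k.+1]. *)
exists (4 * c%:R + E + 1) => [|r].
  by have : 0 <= c%:R :> R by []; lra.
rewrite ge_max => /andP[r1 _]; set C := _ + 1.
have [j /andP[jr rj]] := exists_scale r1.
pose g := MkGphi A (0, (common_multiple j)%:Z).
have g1 : g != 1%g.
  apply/eqP => /(congr1 (@gv _ _)) [v0].
  by have := common_multiple_gt0 j; rewrite v0.
have gC : (word_norm S g)%:R <= C * r.
  have c0 : 0 <= c%:R :> R by [].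
  apply: (@le_trans _ _ ((4 ^ 2 ^ j * c)%N%:R)).
    rewrite ler_nat /g -[Posz _]natz -centerX.
    by rewrite (leq_trans (word_normX _ _ genS.2)) // leq_mul2r common_multiple_le orbT.
  rewrite natrM natrX (le_trans (ler_wpM2r c0 jr)) // /C; nra.
(* [N0] only shows that some normal subgroup of finite index avoids [g], so that [divisibility g] is
   attained. *)
have [l [N0 [n0 [_ _ [nN0 idx0] Ng0 _]]]] := separating_subgroup alt e0 eA g1.
have [N [nN Ng idx]] := divisibility_attained nN0 idx0 Ng0.
have lower := index_lower alt free nN idx (Q := (2 ^ j)%N).
have {}lower : ((2 ^ j) ^ k.+1 <= divisibility g * a ^ k)%N.
  (* As [s] divides the common multiple, [g] is a power of [(0, s)]. *)
  apply: lower => s sj Ns; apply: Ng.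
  have /dvdnP[q qs] := dvdn_common_multiple sj.
  rewrite /g qs mulnC PoszM -[q%:Z]natz mulr_natr -centerX.
  exact: subgroupX nN.1 Ns.
have lnr : 0 <= ln r by rewrite ln_ge0.
have lnD : ln r <= D * (2 ^ j)%N%:R.
  have : ln r <= ln (4 ^+ (2 ^ j.+1)).
    by rewrite ler_ln ?posrE ?exprn_gt0 //; lra.
  by rewrite ln_exp // expnS natrM /D; lra.
rewrite /log_pow; apply: (@le_trans _ _ (E * (divisibility g)%:R)).
  apply: (@le_trans _ _ ((D * (2 ^ j)%N%:R) ^+ k.+1)).
    by rewrite lerXn2r ?nnegrE // (le_trans _ lnD).
  rewrite exprMn /E -mulrA ler_wpM2l ?exprn_ge0 // mulrC -!natrX -natrM ler_nat //.
have := RF_ge genS g1 gC; have : 0 <= (divisibility g)%:R :> R by [].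
have : 0 <= c%:R :> R by [].
rewrite /C; nra.
Qed.
End Growth.

(** * The matrix of a bilinear form, and the conclusion *)

Lemma bilinear_matrix m (phi : {biscalar 'cV[int]_m}) w w' :
  phi w w' = (w^T *m (\matrix_(i, j) phi (delta_mx i 0) (delta_mx j 0)) *m w') 0 0.
Proof.
have cE (u : 'cV[int]_m) : u = \sum_i u i 0 *: delta_mx i 0.
  by rewrite {1}[u]matrix_sum_delta; apply: eq_bigr => i _; rewrite big_ord_recl big_ord0 addr0.
rewrite {1}(cE w') linear_sumr mxE; apply: eq_bigr => j _.
rewrite linearZr_LR {1}(cE w) linear_sumlz mxE /= mulrC; congr (_ * _).
by apply: eq_bigr => i _; rewrite linearZl_LR !mxE.
Qed.

Theorem lemma6p2 (R : realType) (m : nat) (phi : {biscalar 'cV[int]_m})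
    (phi_alt : alternating_form phi) (phi_full : full_form phi) :
  exists A : 'M[int]_m,
    [/\ A^T = - A,
        forall w w' : 'cV[int]_m, phi w w' = (w^T *m A *m w') 0 0
      & RF_growth (Gphi A) (@log_pow R (int_rank A).+1)].
Proof.
pose A : 'M[int]_m := \matrix_(i, j) phi (delta_mx i 0) (delta_mx j 0).
have alt : A^T = - A by apply/matrixP => i j; rewrite !mxE phi_alt.
exists A; split=> // [w w'|]; first exact: bilinear_matrix.
split; [exact: Gphi_finitely_generated|exact: Gphi_residually_finite|].
by move=> S genS; split; [exact: RF_upper|exact: RF_lower].
Qed.
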